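(* Let $V$ be a unital JB-algebra and let $u\in V$ be invertible. The isotope $V_u$ is Jordan isomorphic to $V$ if and only if there exist $v\in\Omega$ and a central symmetry $\varepsilon_p$ of $V$ such that $u=U_v\varepsilon_p=v^2\circ\varepsilon_p$.
   Context: A (unital) JB-algebra is a real Jordan algebra $(V,\circ)$ with unit $1$ (the product is bilinear, commutative and $x^2\circ(x\circ y)=x\circ(x^2\circ y)$) with a complete norm such that $\|x\circ y\|\le\|x\|\|y\|$, $\|x^2\|=\|x\|^2$, $\|x^2\|\le\|x^2+y^2\|$; it may be infinite dimensional. $L_xy=x\circ y$, $U_x=2L_x^2-L_{x^2}$, $U_{x,y}=\frac12(U_{x+y}-U_x-U_y)=L_xL_y+L_yL_x-L_{x\circ y}$. An element $x$ is invertible if $U_x$ is an invertible operator, $\sigma(x)=\{\lambda\in\mathbb R: x-\lambda1\text{ not invertible}\}$, and $\Omega=\{x\in V:\sigma(x)\subset(0,+\infty)\}$. For $u\in V$ invertible, the isotope $V_u$ is the vector space $V$ with the product $x\cdot_uy=U_{x,y}(u)$; it is a unital Jordan algebra with unit $u^{-1}$. A Jordan isomorphism is a linear bijection preserving the Jordan products. A central projection is $p\in V$ with $p^2=p$ and $L_pL_z=L_zL_p$ for all $z\in V$; a central symmetry is $\varepsilon_p=2p-1$ with $p$ a central projection. *)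

(* Defs.v *)
From HB Require Import structures.
From mathcomp Require Import all_boot all_order all_algebra.
From mathcomp Require Import all_classical all_reals all_analysis.

Set Implicit Arguments.
Unset Strict Implicit.
Unset Printing Implicit Defensive.

Import Order.TTheory GRing.Theory Num.Theory.
Import numFieldNormedType.Exports.

Local Open Scope classical_set_scope.
Local Open Scope ring_scope.

Reserved Notation "x ** y" (at level 40, left associativity).

(* Only linearity in the left factor is assumed: with commutativity this is
   bilinearity.  The zero algebra is not excluded. *)
HB.mixin Record Lmodule_isJordan (R : realType) (V : Type)
    of GRing.Lmodule R V := {
  jmul : V -> V -> V;
  jone : V;
  jmulDl : forall x y z : V, jmul (x + y) z = jmul x z + jmul y z;
  jmulZl : forall (a : R) (x y : V), jmul (a *: x) y = a *: jmul x y;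
  jmulC : forall x y : V, jmul x y = jmul y x;
  jmul1x : forall x : V, jmul jone x = x;
  jmul_jordan : forall x y : V,
    jmul (jmul x x) (jmul x y) = jmul x (jmul (jmul x x) y)
}.

#[short(type="jordanAlgType")]
HB.structure Definition JordanAlgebra (R : realType) :=
  { V of GRing.Lmodule R V & Lmodule_isJordan R V }.

Notation "x ** y" := (jmul x y) : ring_scope.

HB.mixin Record Jordan_isJB (R : realType) (V : Type)
    of CompleteNormedModule R V & JordanAlgebra R V := {
  jb_normM : forall x y : V, `|x ** y| <= `|x| * `|y|;
  jb_norm_sq : forall x : V, `|x ** x| = `|x| ^+ 2;
  jb_norm_sqD : forall x y : V, `|x ** x| <= `|x ** x + y ** y|
}.

#[short(type="jbAlgType")]
HB.structure Definition JBAlgebra (R : realType) :=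
  { V of CompleteNormedModule R V & JordanAlgebra R V & Jordan_isJB R V }.

Definition Lop (R : realType) (V : jordanAlgType R) (x : V) : V -> V :=
  fun y => x ** y.

Definition Uop (R : realType) (V : jordanAlgType R) (x : V) : V -> V :=
  fun y => 2%:R *: Lop x (Lop x y) - Lop (x ** x) y.

Definition Uop2 (R : realType) (V : jordanAlgType R) (x y : V) : V -> V :=
  fun z => 2%:R^-1 *: (Uop (x + y) z - Uop x z - Uop y z).

Lemma Uop2E (R : realType) (V : jordanAlgType R) (x y z : V) :
  Uop2 x y z = Lop x (Lop y z) + Lop y (Lop x z) - Lop (x ** y) z.
Proof.
have jDr (a b c : V) : a ** (b + c) = a ** b + a ** c.
  by rewrite jmulC jmulDl !(jmulC a).
apply: (@scalerI _ _ 2%:R); first by rewrite pnatr_eq0.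
rewrite /Uop2 scalerA mulfV ?pnatr_eq0// scale1r /Uop /Lop.
rewrite !(jmulDl, jDr) (jmulC y x) !scalerDr scalerN.
rewrite (scaler_nat 2 ((x ** y) ** z)) mulr2n !opprD !opprK.
set a := 2%:R *: _; set b := 2%:R *: _; set c := 2%:R *: _.
set d := 2%:R *: _.
move: ((x ** x) ** z) ((y ** y) ** z) ((x ** y) ** z) => e f g.
rewrite !addrA [LHS](ACl ((1*9)*(4*11)*(5*10)*(8*12)*(2*3*6*7)))/=.
by rewrite !subrr !addNr !add0r.
Qed.

(* Invertibility of the operator [Uop x] is bijectivity: in a JB-algebra [Uop x]
   is a bounded linear map on a Banach space, so its inverse is linear and
   bounded. *)
Definition jinvertible (R : realType) (V : jordanAlgType R) (x : V) : Prop :=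
  bijective (Uop x).

Definition jspectrum (R : realType) (V : jordanAlgType R) (x : V) : set R :=
  [set l | ~ jinvertible (x - l *: jone)].

Definition jcone (R : realType) (V : jordanAlgType R) : set V :=
  [set x | jspectrum x `<=` [set l | 0 < l]].
Arguments jcone {R} V.

(* The isotope of [V] by [u] is the vector space [V] with this product. *)
Definition isotope_mul (R : realType) (V : jordanAlgType R) (u x y : V) : V :=
  Uop2 x y u.

(* The products are explicit arguments because two of them live on [V]. *)
Definition jordan_isomorphic (R : realType) (V W : lmodType R)
    (mulV : V -> V -> V) (mulW : W -> W -> W) : Prop :=
  exists f : {linear V -> W},
    bijective f /\ (forall x y, f (mulV x y) = mulW (f x) (f y)).

Definition central_projection (R : realType) (V : jordanAlgType R) (p : V)
    : Prop :=
  p ** p = p /\ (forall z : V, Lop p \o Lop z = Lop z \o Lop p).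

Definition csym (R : realType) (V : jordanAlgType R) (p : V) : V :=
  2%:R *: p - jone.

(* Main.v *)
From HB Require Import structures.
Require Import Defs.
From mathcomp Require Import all_boot all_order all_algebra.
From mathcomp Require Import all_classical all_reals all_analysis.
From mathcomp Require Import ring lra.

(* Since U_{U_v w} = U_v U_w U_v, the operator U_v is a Jordan isomorphism from
   V_{U_v w} onto V_w when v is invertible, and for a central symmetry e the
   multiplication by e is one from V_e onto V.  Conversely, square roots in the
   closed associative algebra generated by u give u = U_v s with v in the cone
   and s^2 = 1, so V_s is isomorphic to V.  If s x = 0, the square of x in V_s is
   - s x^2, whereas s x^2 is, up to e s with e > 0 arbitrary, a square in V_s;
   as V is formally real, x = 0.  Hence L_s, which satisfies L_s^3 = L_s, is
   an involution, and the linearized Jordan identity makes s central. *)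

Set Implicit Arguments.
Unset Strict Implicit.
Unset Printing Implicit Defensive.

Import Order.TTheory GRing.Theory Num.Theory.
Import numFieldNormedType.Exports.

Local Open Scope classical_set_scope.
Local Open Scope ring_scope.

(** * Linear identities in modules *)

Section LinearExpressions.
Variables (R : realType) (V : lmodType R).

(** Reflection for linear identities: an equality of linear combinations reduces to one scalar
    equality per atom. *)
Inductive lexpr :=
  | LVar of nat
  | LZero
  | LAdd of lexpr & lexpr
  | LOpp of lexpr
  | LScale of R & lexpr.

Fixpoint leval (env : seq V) (e : lexpr) : V :=
  match e with
  | LVar i => env`_i
  | LZero => 0
  | LAdd e1 e2 => leval env e1 + leval env e2
  | LOpp e1 => - leval env e1
  | LScale a e1 => a *: leval env e1
  end.

Fixpoint lcoef (e : lexpr) (i : nat) : R :=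
  match e with
  | LVar j => if eqn i j then 1 else 0
  | LZero => 0
  | LAdd e1 e2 => lcoef e1 i + lcoef e2 i
  | LOpp e1 => - lcoef e1 i
  | LScale a e1 => a * lcoef e1 i
  end.

(** A nested conjunction, which [cbn] and [split] turn into scalar goals for [ring] or [field]. *)
Fixpoint lcoef_eq (n : nat) (e1 e2 : lexpr) : Prop :=
  if n is m.+1 then lcoef e1 m = lcoef e2 m /\ lcoef_eq m e1 e2 else True.

Lemma levalE (env : seq V) (e : lexpr) :
  leval env e = \sum_(i < size env) lcoef e i *: env`_i.
Proof.
have eqnD (i k : nat) : eqn i k = (i == k) by [].
elim: e => [j||e1 IH1 e2 IH2|e1 IH1|a e1 IH1] /=.
- have [lt_j|le_j] := ltnP j (size env).
    rewrite (bigD1 (Ordinal lt_j))//= eqnD eqxx scale1r big1 ?addr0// => i.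
    by rewrite -val_eqE /= eqnD => /negbTE ->; rewrite scale0r.
  rewrite nth_default// big1// => i _; rewrite eqnD.
  by rewrite ltn_eqF ?scale0r// (leq_trans (ltn_ord i)).
- by rewrite big1// => i _; rewrite scale0r.
- by rewrite IH1 IH2 -big_split; apply: eq_bigr => i _; rewrite scalerDl.
- by rewrite IH1 -sumrN; apply: eq_bigr => i _; rewrite scaleNr.
- by rewrite IH1 scaler_sumr; apply: eq_bigr => i _; rewrite scalerA.
Qed.

Lemma leval_eq (env : seq V) (e1 e2 : lexpr) :
  lcoef_eq (size env) e1 e2 -> leval env e1 = leval env e2.
Proof.
rewrite !levalE => eq12; apply: eq_bigr => i _; congr (_ *: _).
elim: (size env) (val i) (ltn_ord i) eq12 => //= m IHm k.
rewrite ltnS leq_eqVlt => /orP[/eqP -> []//|lt_km [_ ?]]; exact: IHm.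
Qed.

End LinearExpressions.
Arguments LVar {R} _.
Arguments LZero {R}.

Ltac lmod_mem x env :=
  match env with
  | nil => constr:(false)
  | x :: _ => constr:(true)
  | _ :: ?t => lmod_mem x t
  end.
Ltac lmod_index x env :=
  match env with
  | x :: _ => constr:(0%N)
  | _ :: ?t => let n := lmod_index x t in constr:(S n)
  end.
Ltac lmod_atoms t env :=
  match t with
  | 0 => env
  | ?a + ?b => let env1 := lmod_atoms a env in lmod_atoms b env1
  | - ?a => lmod_atoms a env
  | _ *: ?a => lmod_atoms a env
  | _ => match lmod_mem t env with
         | true => env
         | false => constr:(t :: env)
         end
  end.
Ltac lmod_reify R t env :=
  match t with
  | 0 => constr:(@LZero R)
  | ?a + ?b => let e1 := lmod_reify R a env in
               let e2 := lmod_reify R b env in constr:(LAdd e1 e2)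
  | - ?a => let e1 := lmod_reify R a env in constr:(LOpp e1)
  | ?c *: ?a => let e1 := lmod_reify R a env in constr:(LScale c e1)
  | _ => let n := lmod_index t env in constr:(@LVar R n)
  end.
Ltac lmod R :=
  match goal with
  | |- @eq ?T ?a ?b =>
    let env0 := lmod_atoms a (@nil T) in
    let env := lmod_atoms b env0 in
    let e1 := lmod_reify R a env in
    let e2 := lmod_reify R b env in
    apply: (@leval_eq R _ env e1 e2);
    cbn [size lcoef_eq lcoef eqn]; repeat split; first [ring | by field]
  end.

(** * Jordan identities and the fundamental formula *)

Section JordanIdentities.
Variables (R : realType) (V : jordanAlgType R).
Implicit Types a b c d w x y z : V.

Lemma jmulDr x y z : x ** (y + z) = x ** y + x ** z.
Proof. by rewrite jmulC jmulDl !(jmulC x). Qed.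

Lemma jmulZr (k : R) x y : x ** (k *: y) = k *: (x ** y).
Proof. by rewrite jmulC jmulZl (jmulC x). Qed.

Lemma jmulx1 x : x ** jone = x.
Proof. by rewrite jmulC jmul1x. Qed.

Lemma jmulNl x y : (- x) ** y = - (x ** y).
Proof. by rewrite -scaleN1r jmulZl scaleN1r. Qed.

Lemma jmulNr x y : x ** (- y) = - (x ** y).
Proof. by rewrite jmulC jmulNl jmulC. Qed.

Lemma jmul0r x : x ** 0 = 0.
Proof. by rewrite -(scale0r (0 : V)) jmulZr !scale0r. Qed.

Definition jmulE := (@jmulDl R V, jmulDr, jmulNl, jmulNr, @jmulZl R V, jmulZr,
  @jmul1x R V, jmulx1).

Lemma scaler2_inj x y : 2%:R *: x = 2%:R *: y -> x = y.
Proof. by apply: scalerI; rewrite pnatr_eq0. Qed.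

Lemma jordan_linearized a b c y :
  a ** ((b ** c) ** y) + b ** ((c ** a) ** y) + c ** ((a ** b) ** y) =
  (b ** c) ** (a ** y) + (c ** a) ** (b ** y) + (a ** b) ** (c ** y).
Proof.
pose f x := (x ** x) ** (x ** y) - x ** ((x ** x) ** y).
have f0 x : f x = 0 by rewrite /f jmul_jordan subrr.
apply: scaler2_inj; apply/eqP; rewrite -subr_eq0 -scalerBr; apply/eqP.
(* Inclusion-exclusion extracts the trilinear part of the cubic map [f]; each product occurs in it
   twice, hence the factor 2. *)
transitivity (- (f (a + b + c) - f (a + b) - f (b + c) - f (a + c)
              + f a + f b + f c)); last by rewrite !f0; lmod R.
rewrite /f !jmulE (jmulC b a) (jmulC c a) (jmulC c b).
lmod R.
Qed.

End JordanIdentities.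

(** Adds [k] times a known identity to the goal, so that a formal linear identity remains for
    [lmod]. *)
Lemma lmod_add_eq (R : realType) (V : lmodType R) (k : R) (l r x y : V) :
  l = r -> x + k *: l = y + k *: r -> x = y.
Proof. by move=> -> /addIr. Qed.
Arguments lmod_add_eq {R V} k {l r x y}.

(** Makes a product and its commuted form a single atom for [lmod]. *)
Ltac jmul_sort :=
  repeat match goal with
  | |- context [@jmul ?R ?V ?x ?y] =>
    lazymatch x with
    | y => fail
    | _ => match goal with
           | |- context [@jmul R V y x] => rewrite (@jmulC R V y x)
           end
    end
  end.

(** The Jordan triple product, that is [U_{x,z} y]. *)
Definition jtriple (R : realType) (V : jordanAlgType R) (x y z : V) : V :=
  (x ** y) ** z + x ** (y ** z) - y ** (x ** z).

Section TripleProduct.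
Variables (R : realType) (V : jordanAlgType R).
Implicit Types a b c d w x y z : V.
Local Notation "{[ x , y , z ]}" := (jtriple x y z).

Lemma jtripleC x y z : {[x, y, z]} = {[z, y, x]}.
Proof. rewrite /jtriple; jmul_sort; lmod R. Qed.

Lemma jtripleDl x x' y z : {[x + x', y, z]} = {[x, y, z]} + {[x', y, z]}.
Proof. rewrite /jtriple !jmulE; lmod R. Qed.

Lemma jtripleDm x y y' z : {[x, y + y', z]} = {[x, y, z]} + {[x, y', z]}.
Proof. rewrite /jtriple !jmulE; lmod R. Qed.

Lemma jtripleDr x y z z' : {[x, y, z + z']} = {[x, y, z]} + {[x, y, z']}.
Proof. rewrite /jtriple !jmulE; lmod R. Qed.

Lemma jtripleZm k x y z : {[x, k *: y, z]} = k *: {[x, y, z]}.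
Proof. rewrite /jtriple !jmulE; lmod R. Qed.

Lemma jtripleZl k x y z : {[k *: x, y, z]} = k *: {[x, y, z]}.
Proof. rewrite /jtriple !jmulE; lmod R. Qed.

Lemma jtripleZr k x y z : {[x, y, k *: z]} = k *: {[x, y, z]}.
Proof. rewrite /jtriple !jmulE; lmod R. Qed.

Lemma jtripleNl x y z : {[- x, y, z]} = - {[x, y, z]}.
Proof. by rewrite -scaleN1r jtripleZl scaleN1r. Qed.

Lemma jtripleNm x y z : {[x, - y, z]} = - {[x, y, z]}.
Proof. by rewrite -scaleN1r jtripleZm scaleN1r. Qed.

Lemma jtripleNr x y z : {[x, y, - z]} = - {[x, y, z]}.
Proof. by rewrite -scaleN1r jtripleZr scaleN1r. Qed.

Lemma UopE x y : Uop x y = {[x, y, x]}.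
Proof. rewrite /Uop /Lop /jtriple; jmul_sort; lmod R. Qed.

Lemma isotope_mulE x y z : isotope_mul x y z = {[y, x, z]}.
Proof. rewrite /isotope_mul Uop2E /Lop /jtriple; jmul_sort; lmod R. Qed.

(** [L_z] lies in the structure Lie algebra, with [- L_z] acting on the middle slot. Three instances
    of [jordan_linearized] combine to this. *)
Lemma jmul_jtriple z a b c :
  z ** {[a, b, c]} = {[z ** a, b, c]} - {[a, z ** b, c]} + {[a, b, z ** c]}.
Proof.
rewrite /jtriple !jmulE.
apply: (lmod_add_eq (-1) (jordan_linearized z a b c)).
apply: (lmod_add_eq 1 (jordan_linearized a z c b)).
apply: (lmod_add_eq (-1) (jordan_linearized b z c a)).
jmul_sort; lmod R.
Qed.

(* [fun z => {[x, y, z]}] is multiplication by [x ** y] plus the inner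
   derivation [L_x L_y - L_y L_x]. *)
Lemma jtriple_jtriple x y a b c :
  {[x, y, {[a, b, c]}]} =
  {[{[x, y, a]}, b, c]} - {[a, {[y, x, b]}, c]} + {[a, b, {[x, y, c]}]}.
Proof.
have tripleE u v w :
    {[u, v, w]} = (u ** v) ** w + u ** (v ** w) - v ** (u ** w).
  by [].
rewrite [LHS](tripleE x y) !(jmul_jtriple, jmulE).
rewrite (tripleE x y a) (tripleE y x b) (tripleE x y c).
rewrite !(jtripleDl, jtripleDm, jtripleDr, jtripleNl, jtripleNm, jtripleNr).
rewrite (jmulC y x); lmod R.
Qed.

Lemma jtriple_quadratic a b x c :
  {[a, b, {[x, c, x]}]} = 2%:R *: {[{[a, b, x]}, c, x]} - {[x, {[b, a, c]}, x]}.
Proof. rewrite jtriple_jtriple (jtripleC x c {[a, b, x]}); lmod R. Qed.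

(** Let A and B be the two sides. The instances of [jtriple_quadratic] for (y, c) and (c, y) share
    the term [{x,{y,x,c},x}]; their difference is A - B = 2B - 2A, so 3A = 3B. *)
Lemma jtriple_shift x y c : {[x, y, {[x, c, x]}]} = {[x, c, {[x, y, x]}]}.
Proof.
apply: (@scalerI _ _ 3%:R); first by rewrite pnatr_eq0.
have h1 := jtriple_quadratic x y x c.
have h2 := jtriple_quadratic x c x y.
rewrite (jtripleC {[x, y, x]}) in h1.
rewrite (jtripleC {[x, c, x]}) (jtripleC c) in h2.
apply: (lmod_add_eq (-1) h1); apply: (lmod_add_eq 1 h2); lmod R.
Qed.

Lemma jtriple_homotope x y c : {[x, y, {[x, c, x]}]} = {[x, {[y, x, c]}, x]}.
Proof.
have := jtriple_quadratic x y x c.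
rewrite (jtripleC {[x, y, x]}) -(jtriple_shift x y c) => h.
apply: (lmod_add_eq 1 h); lmod R.
Qed.

(* [z |-> {[y, x, z]}] commutes with itself; expand by [jtriple_jtriple]. *)
Lemma jtriple_quadratic_swap x y z :
  {[{[y, x, y]}, x, z]} = {[y, {[x, y, x]}, z]}.
Proof.
have h := jtriple_jtriple y x y x z.
apply: (lmod_add_eq 1 h); lmod R.
Qed.

(** With X = [U_x y], expanding one X and pulling [x] to the outside gives [U_X z = U_x
    (2{y,x,{z,x,y}} - {{y,x,y},x,z})]; by [jtriple_quadratic] the argument of [U_x] is
    [U_y U_x z]. *)
Lemma Uop_fundamental x y z : Uop (Uop x y) z = Uop x (Uop y (Uop x z)).
Proof.
rewrite !UopE; set X := {[x, y, x]}.
rewrite {2}/X jtriple_quadratic (jtripleC X z x) jtriple_homotope.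
rewrite (jtripleC {[x, _, x]} y x) jtriple_homotope.
rewrite (jtripleC z X y) -jtriple_quadratic_swap.
have h := jtriple_quadratic z x y x.
rewrite (jtripleC z x {[y, x, y]}) (jtripleC {[z, x, y]} x y) in h.
rewrite h (jtripleDm x (2%:R *: _)) (jtripleNm x {[y, _, y]}) (jtripleZm 2%:R).
by rewrite opprD opprK addNKr.
Qed.

Lemma UopD x y z : Uop x (y + z) = Uop x y + Uop x z.
Proof. by rewrite !UopE jtripleDm. Qed.

Lemma UopZ x k y : Uop x (k *: y) = k *: Uop x y.
Proof. by rewrite !UopE jtripleZm. Qed.

Lemma UopN x y : Uop x (- y) = - Uop x y.
Proof. by rewrite -scaleN1r UopZ scaleN1r. Qed.

(** The fundamental formula polarized in its middle operator. *)
Lemma Uop_isotope v w x y :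
  Uop v (isotope_mul (Uop v w) x y) = isotope_mul w (Uop v x) (Uop v y).
Proof.
rewrite /isotope_mul /Uop2 -(UopD v x y) !Uop_fundamental UopZ.
move: (Uop (x + y) _) (Uop x _) (Uop y _) => p q r.
by rewrite !UopD !UopN.
Qed.

Lemma Uop_onel x : Uop jone x = x.
Proof. rewrite /Uop /Lop !jmulE; lmod R. Qed.

(** If [U_x y = 1], the fundamental formula gives [U_x U_y U_x = id], so [U_x] is both injective and
    surjective. *)
Lemma jinvertibleP x : jinvertible x <-> exists y, Uop x y = jone.
Proof.
split=> [[g _ gK]|[y xy1]]; first by exists (g jone).
have xyxK z : Uop x (Uop y (Uop x z)) = z.
  by rewrite -Uop_fundamental xy1 Uop_onel.
exists (Uop y \o Uop x) => z /=; last exact: xyxK.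
by rewrite -[RHS]xyxK -[in RHS](xyxK (Uop x z)) xyxK.
Qed.

Definition Uop_linear x : {linear V -> V} :=
  HB.pack (Uop x) (GRing.isLinear.Build R V V *:%R (Uop x)
    (fun k y z => etrans (UopD x (k *: y) z) (congr1 (+%R^~ _) (UopZ x k y)))).

Lemma isotope_isomorphic v w : jinvertible v ->
  jordan_isomorphic (isotope_mul (Uop v w)) (isotope_mul w).
Proof.
move=> v_inv; exists (Uop_linear v); split=> // x y; exact: Uop_isotope.
Qed.

End TripleProduct.

Section Isomorphism.
Variables (R : realType) (U V W : lmodType R).

Lemma jordan_isomorphic_trans (mU : U -> U -> U) (mV : V -> V -> V)
    (mW : W -> W -> W) :
  jordan_isomorphic mU mV -> jordan_isomorphic mV mW -> jordan_isomorphic mU mW.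
Proof.
move=> [f [f_bij fM]] [g [g_bij gM]]; exists (g \o f)%FUN; split.
  exact: bij_comp.
by move=> x y /=; rewrite fM gM.
Qed.

End Isomorphism.

(** * The closed associative algebra generated by an element *)

Section OperatorCommutation.
Variables (R : realType) (V : jordanAlgType R).
Implicit Types a x y w : V.

Definition jmul_linear x : {linear V -> V} :=
  HB.pack (jmul x : V -> V) (GRing.isLinear.Build R V V *:%R (jmul x)
    (fun k y z =>
      etrans (jmulDr x (k *: y) z) (congr1 (+%R^~ _) (jmulZr k x y)))).

Definition opcomm x y : Prop := forall w, x ** (y ** w) = y ** (x ** w).

Lemma opcomm_sqr x : opcomm x (x ** x).
Proof. by move=> w; rewrite jmul_jordan. Qed.

Lemma opcommC x y : opcomm x y -> opcomm y x.
Proof. by move=> xy w; rewrite xy. Qed.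

Lemma opcomm_linear k x x' y :
  opcomm x y -> opcomm x' y -> opcomm (k *: x + x') y.
Proof. by move=> xy x'y w; rewrite !jmulE xy x'y. Qed.

(** The linearized Jordan identity solved for [L_{a(ax)}]: it is a polynomial in [L_a], [L_{a^2}],
    [L_x] and [L_{ax}], so it commutes with whatever commutes with these four. *)
Lemma jmul_sqr_expand a x w : (a ** (a ** x)) ** w =
  2%:R *: ((a ** x) ** (a ** w)) + (a ** a) ** (x ** w)
  - a ** (a ** (x ** w)) - x ** (a ** (a ** w)).
Proof.
apply: (lmod_add_eq (-1) (jordan_linearized a x w a)).
jmul_sort; lmod R.
Qed.

Lemma opcomm_mul_mul a x y :
  opcomm a y -> opcomm (a ** a) y -> opcomm x y -> opcomm (a ** x) y ->
  opcomm (a ** (a ** x)) y.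
Proof.
move=> ay aay xy axy w.
by rewrite !jmul_sqr_expand !(ay, aay, xy, axy) !jmulE.
Qed.

(* [L_x L_{y^2} - L_{y^2} L_x = -2 (L_y L_{xy} - L_{xy} L_y)]. *)
Lemma opcomm_sqr_of_mul x y : opcomm y (x ** y) -> opcomm x (y ** y).
Proof.
move=> yxy w; have h := jordan_linearized x y y w.
rewrite -(jmulC x y) !yxy in h.
apply: (lmod_add_eq (-1) h); lmod R.
Qed.

End OperatorCommutation.

Section GeneratedAlgebra.
Variables (R : realType) (V : jbAlgType R).
Implicit Types (a x y z w : V) (S : set V).

Lemma jmul_continuous x : continuous (jmul x : V -> V).
Proof.
apply: (@bounded_linear_continuous _ _ _ (jmul_linear x)).
apply/bounded_funP => r; exists (`|x| * r) => y y_r.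
by rewrite (le_trans (jb_normM _ _))// ler_wpM2l.
Qed.

Lemma continuous_jmulr x (f : V -> V) :
  continuous f -> continuous (fun y => x ** f y).
Proof.
move=> f_cont y; apply: (@continuous_comp _ _ _ f (jmul x)).
  exact: f_cont.
exact: jmul_continuous.
Qed.

Lemma continuous_jmull x (f : V -> V) :
  continuous f -> continuous (fun y => f y ** x).
Proof.
move=> f_cont; rewrite (_ : (fun y => f y ** x) = (fun y => x ** f y)).
  exact: continuous_jmulr.
by apply/funext => y; rewrite jmulC.
Qed.

Lemma closed_equalizer (f g : V -> V) : continuous f -> continuous g ->
  closed [set x | f x = g x].
Proof.
move=> f_cont g_cont.
rewrite (_ : [set x | f x = g x] = (fun x => `|f x - g x|) @^-1` [set 0]).
  apply: preimage_closed; last exact: closed_eq.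
  move=> x _; apply: cvg_norm; apply: cvgB; [exact: f_cont|exact: g_cont].
by apply/seteqP; split => x /= => [->|/normr0_eq0/subr0_eq//];
  rewrite subrr normr0.
Qed.

Definition closed_unital_subspace S : Prop :=
  [/\ closed S, S jone & forall k x y, S x -> S y -> S (k *: x + y)].

(** Only stability under [L_a] is built in. Stability under products and associativity follow from
    operator commutation, in [gen_algM] and [gen_algA]. *)
Definition gen_alg a : set V :=
  [set y | forall S, closed_unital_subspace S ->
             (forall x, S x -> S (a ** x)) -> S y].

Lemma gen_alg_subspace a : closed_unital_subspace (gen_alg a).
Proof.
split=> [|S [] //|k x y xa ya S S_sub Sa]; last first.
  have [_ _ S_lin] := S_sub; apply: S_lin; [exact: xa|exact: ya].
move=> x x_cl S S_sub Sa; have [S_closed _ _] := S_sub.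
by apply: S_closed; apply: closureS x_cl => y; apply.
Qed.

Lemma gen_alg1 a : gen_alg a jone.
Proof. by have [] := gen_alg_subspace a. Qed.

Lemma gen_algD a x y : gen_alg a x -> gen_alg a y -> gen_alg a (x + y).
Proof.
by have [_ _ H] := gen_alg_subspace a; rewrite -{2}(scale1r x); exact: H.
Qed.

Lemma gen_algZ a k x : gen_alg a x -> gen_alg a (k *: x).
Proof.
have [_ H1 H] := gen_alg_subspace a => xa.
(* The linearity clause yields 0 only as a combination of elements of the set, here of the unit. *)
have -> : k *: x = k *: x + (-1 *: jone + jone) by rewrite scaleN1r addNr addr0.
exact: (H k x _ xa (H (-1) jone jone H1 H1)).
Qed.

Lemma gen_algB a x y : gen_alg a x -> gen_alg a y -> gen_alg a (x - y).
Proof.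
by move=> xa ya; rewrite -scaleN1r; apply: gen_algD xa _; exact: gen_algZ.
Qed.

Lemma gen_alg_mull a x : gen_alg a x -> gen_alg a (a ** x).
Proof. move=> xa S S_sub Sa; exact: Sa (xa S S_sub Sa). Qed.

Lemma gen_alg_id a : gen_alg a a.
Proof. by have := gen_alg_mull (@gen_alg1 a); rewrite jmulx1. Qed.

(** The induction carries [a ** x] along with [x], because [opcomm_mul_mul] needs both to reach
    [a ** (a ** x)]. *)
Lemma gen_alg_opcommr a y : opcomm a y -> opcomm (a ** a) y ->
  forall x, gen_alg a x -> opcomm x y.
Proof.
have id_cont : continuous (@idfun V) by move=> z; exact: cvg_id.
move=> ay aay x xa.
apply: (proj1 (xa [set x | opcomm x y /\ opcomm (a ** x) y] _ _)) => {x xa}.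
  split.
  - rewrite (_ : [set x | _] = \bigcap_w ([set x | x ** (y ** w) = y ** (x ** w)]
       `&` [set x | (a ** x) ** (y ** w) = y ** ((a ** x) ** w)])).
      apply: closed_bigI => w _; apply: closedI; apply: closed_equalizer.
      + exact: (continuous_jmull id_cont).
      + exact: (continuous_jmulr (continuous_jmull id_cont)).
      + exact: (continuous_jmull (@jmul_continuous a)).
      + exact: (continuous_jmulr (continuous_jmull (@jmul_continuous a))).
    apply/seteqP; split=> x /=.
      by move=> [xy axy] w _; split; [exact: xy|exact: axy].
    by move=> H; split=> w; have [] := H w I.
  - by split; [move=> w; rewrite !jmul1x|rewrite jmulx1].
  - move=> k x z /= [xy axy] [zy azy]; split; first exact: opcomm_linear.
    by rewrite jmulDr jmulZr; exact: opcomm_linear.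
by move=> x /= [xy axy]; split=> //; exact: opcomm_mul_mul.
Qed.

Lemma gen_alg_opcomm a x y : gen_alg a x -> gen_alg a y -> opcomm x y.
Proof.
move=> xa ya; have aa := opcomm_sqr a.
by apply: gen_alg_opcommr xa; apply/opcommC; apply: gen_alg_opcommr ya => //;
  exact/opcommC.
Qed.

Lemma gen_algM a x y : gen_alg a x -> gen_alg a y -> gen_alg a (x ** y).
Proof.
move=> xa ya; have [a_closed _ a_lin] := gen_alg_subspace a.
apply: (ya [set y | gen_alg a (x ** y)]) => [|z xz]; last first.
  rewrite /= (gen_alg_opcomm xa (@gen_alg_id a)); exact: gen_alg_mull.
split=> [||k y1 y2] /=.
- by apply: preimage_closed a_closed => z _; exact: jmul_continuous.
- by rewrite jmulx1.
- by rewrite jmulDr jmulZr; exact: a_lin.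
Qed.

(** For a commutative product, associativity is commutation of multiplications: x(yz) = x(zy) =
    z(xy). *)
Lemma gen_algA a x y z : gen_alg a x -> gen_alg a y -> gen_alg a z ->
  x ** (y ** z) = (x ** y) ** z.
Proof.
by move=> xa ya za; rewrite (jmulC y z) (gen_alg_opcomm xa za) jmulC.
Qed.

Lemma gen_alg_Uop a x y : gen_alg a x -> gen_alg a y -> Uop x y = (x ** x) ** y.
Proof.
move=> xa ya; rewrite /Uop /Lop (gen_algA xa xa ya); lmod R.
Qed.

Lemma gen_alg_jinvertible a x y : gen_alg a x -> gen_alg a y ->
  x ** y = jone -> jinvertible x.
Proof.
move=> xa ya xy1; apply/jinvertibleP; exists (y ** y).
rewrite (gen_alg_Uop xa (gen_algM ya ya)) -(gen_algA xa xa (gen_algM ya ya)).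
by rewrite (gen_algA xa ya ya) xy1 jmul1x.
Qed.

End GeneratedAlgebra.

(** * Square roots and polar decomposition *)

Section FunctionalCalculus.
Variables (R : realType) (V : jbAlgType R).
Implicit Types (a r s t u v w x y z : V).

Lemma jb_norm1 : `|jone : V| <= 1.
Proof.
have := jb_norm_sq (jone : V); rewrite jmul1x expr2 => h.
by have := normr_ge0 (jone : V); nra.
Qed.

Lemma Uop_norm x y : `|Uop x y| <= 3%:R * `|x| ^+ 2 * `|y|.
Proof.
rewrite /Uop /Lop (le_trans (ler_normB _ _))// normrZ ger0_norm//.
have h1 := jb_normM x (x ** y); have h2 := jb_normM x y.
have h3 := jb_normM (x ** x) y; rewrite jb_norm_sq in h3.
have : `|x| * `|x ** y| <= `|x| * (`|x| * `|y|) by rewrite ler_wpM2l.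
by move: h1 h3; rewrite expr2 => *; lra.
Qed.

Lemma contraction_fixpoint (U : set V) (f : V -> V) (q : R) :
  closed U -> U !=set0 -> (forall x, U x -> U (f x)) -> 0 <= q -> q < 1 ->
  (forall x y, U x -> U y -> `|f x - f y| <= q * `|x - y|) ->
  exists2 x, U x & x = f x.
Proof.
move=> U_closed U0 fU q0 q1 f_lip.
pose F : {fun U >-> U} := HB.pack f (isFun.Build _ _ U U f fU).
apply: (@banach_fixed_point _ _ U F _ U_closed U0).
exists (NngNum q0); split=> // -[x y] [/= Ux Uy]; exact: f_lip.
Qed.

Lemma gen_alg_closed a : closed (gen_alg a : set V).
Proof. by have [] := gen_alg_subspace a. Qed.

(** The Neumann series as a fixed point: x = z + zx gives (1 - z)(1 + x) = 1. *)
Lemma gen_alg_inv a z : gen_alg a z -> `|z| < 1 ->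
  exists2 y, gen_alg a y & (jone - z) ** y = jone.
Proof.
move=> za z1.
have [||x xa|||x y xa ya|x xa xE] := @contraction_fixpoint (gen_alg a)
    (fun x => z + z ** x) `|z|.
- exact: gen_alg_closed.
- by exists jone; exact: gen_alg1.
- by apply: gen_algD => //; exact: gen_algM.
- by [].
- by [].
- rewrite (_ : _ - _ = z ** (x - y)) ?jb_normM// !jmulE; lmod R.
exists (jone + x); first by apply: gen_algD => //; exact: gen_alg1.
rewrite !jmulE {1}xE; lmod R.
Qed.

(* Solve [t = (z + t^2) / 2] by iteration. *)
Lemma gen_alg_sqrt a z : gen_alg a z -> `|z| < 1 ->
  exists t, [/\ gen_alg a t, `|t| <= `|z|
    & (jone - t) ** (jone - t) = jone - z].
Proof.
move=> za z1.
have [||t [ta tz]|||x y [xa xz] [ya yz]|t [ta tz] tE] :=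
    @contraction_fixpoint (gen_alg a `&` [set t | `|t| <= `|z|])
    (fun t => 2%:R^-1 *: (z + t ** t)) `|z|.
- apply: closedI; first exact: gen_alg_closed.
  rewrite (_ : [set t | _] = (fun t : V => `|t|) @^-1` [set r | r <= `|z|])//.
  apply: preimage_closed; last exact: closed_le.
  by move=> x _; exact: norm_continuous.
- by exists z; split=> /=.
- split; first by apply: gen_algZ; apply: gen_algD => //; exact: gen_algM.
  rewrite /= normrZ ger0_norm ?invr_ge0//.
  have := ler_normD z (t ** t); rewrite jb_norm_sq expr2 => h.
  have tt : `|t| * `|t| <= `|t| by rewrite ler_piMr// ltW// (le_lt_trans tz).
  by rewrite /= in tz; rewrite ler_pdivrMl//; lra.
- by [].
- by [].
(* Factoring x^2 - y^2, with |x + y| at most 2|z| on the ball, gives the contraction constant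
   |z|. *)
- rewrite -scalerBr (_ : _ - _ = (x + y) ** (x - y)); last first.
    by rewrite !jmulE (jmulC y x); lmod R.
  rewrite normrZ ger0_norm ?invr_ge0//.
  rewrite -(ler_pM2l (ltr0n R 2)) mulrA mulfV ?pnatr_eq0// mul1r mulrA.
  rewrite (le_trans (jb_normM _ _))// ler_wpM2r//.
  by rewrite (le_trans (ler_normD _ _))//; move: xz yz; rewrite /=; lra.
exists t; split=> //; rewrite !jmulE.
have -> : t ** t = 2%:R *: t - z.
  by rewrite {3}tE scalerA mulfV ?pnatr_eq0// scale1r addrC addKr.
lmod R.
Qed.

(** As 1 - x^2 is a square, its norm is at most that of (1 - x^2) + x^2 = 1. *)
Lemma norm_one_sub_sqr x : `|x| < 1 -> `|jone - x ** x| <= 1.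
Proof.
move=> x1.
have xx1 : `|x ** x| < 1 by rewrite jb_norm_sq expr_lt1.
have [t [_ _ tE]] := gen_alg_sqrt (@gen_alg_id _ _ (x ** x)) xx1.
rewrite -tE (le_trans (jb_norm_sqD _ x))// tE subrK; exact: jb_norm1.
Qed.

(* [U_u] is bounded below, with inverse [U_u U_y]; hence the inverses of
   [e + u^2] stay bounded as [e] tends to 0, which makes [u^2] invertible. *)
Lemma gen_alg_sqr_inv u : jinvertible u -> `|u| < 1 ->
  exists2 w, gen_alg u w & (u ** u) ** w = jone.
Proof.
move=> /jinvertibleP[y uy1] u1.
have ua := @gen_alg_id _ _ u; have a1 := @gen_alg1 _ _ u.
have uua := gen_algM ua ua.
(* The 9 comes from [Uop_norm] applied to [U_u] and to [U_y]; the added 1 makes [C] positive. *)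
pose C : R := 9%:R * `|y| ^+ 2 + 1.
have C0 : 0 < C by rewrite ltr_wpDl// mulr_ge0// sqr_ge0.
have bound z : gen_alg u z -> `|z| <= C * `|(u ** u) ** z|.
  move=> za; rewrite -(gen_alg_Uop ua za).
  have zE : z = Uop u (Uop y (Uop u z)).
    by rewrite -Uop_fundamental uy1 Uop_onel.
  have h1 := Uop_norm u (Uop y (Uop u z)); have h2 := Uop_norm y (Uop u z).
  have u2 : `|u| ^+ 2 <= 1 by rewrite expr_le1// ltW.
  have h3 : 3%:R * `|u| ^+ 2 * `|Uop y (Uop u z)| <= 3%:R * `|Uop y (Uop u z)|.
    by rewrite ler_wpM2r// -[leRHS]mulr1 ler_wpM2l.
  rewrite {1}zE; apply: (le_trans h1); apply: (le_trans h3).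
  have N0 : 0 <= `|Uop u z| by exact: normr_ge0.
  by rewrite /C mulrDl mul1r; lra.
(* Now e C = 1/3, so the inverse [E] of u^2 + e below satisfies |eE| <= (1 + |eE|)/3, whence |eE| <
   1. *)
pose e := (3%:R * C)^-1.
have e0 : 0 < e by rewrite invr_gt0 mulr_gt0.
have eC : 3%:R * e * C = 1 by rewrite /e; field; exact: lt0r_neq0.
have e1 : 1 + e != 0 by rewrite lt0r_neq0// addr_gt0.
(* This inverts u^2 + e = (1 + e)(1 - (1 + e)^-1 (1 - u^2)). *)
have [y0 y0a y0E] : exists2 y, gen_alg u y &
    (jone - (1 + e)^-1 *: (jone - u ** u)) ** y = jone.
  apply: gen_alg_inv; first by apply: gen_algZ; exact: gen_algB.
  rewrite normrZ ger0_norm; last by rewrite invr_ge0 addr_ge0// ltW.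
  rewrite (@le_lt_trans _ _ (1 + e)^-1)//.
    by rewrite -[leRHS]mulr1 ler_wpM2l ?norm_one_sub_sqr// invr_ge0 addr_ge0// ltW.
  by rewrite invf_lt1 ?ltrDl// addr_gt0.
pose E := (1 + e)^-1 *: y0.
have Ea : gen_alg u E by exact: gen_algZ.
have uuE : (u ** u) ** E = jone - e *: E.
  rewrite -y0E /E !jmulE.
  apply/eqP; rewrite -subr_eq0; apply/eqP.
  rewrite (_ : _ - _ = (-1 + (1 + e) * (1 + e)^-1) *: y0); last lmod R.
  by rewrite mulfV// addNr scale0r.
have eE : `|e *: E| < 1.
  rewrite normrZ (ger0_norm (ltW e0)).
  have := bound _ Ea; rewrite uuE => h1.
  have h2 : `|jone - e *: E| <= 1 + e * `|E|.
    rewrite (le_trans (ler_normB _ _))// normrZ (ger0_norm (ltW e0)).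
    by rewrite lerD2r jb_norm1.
  have h3 : `|E| <= C * (1 + e * `|E|) by rewrite (le_trans h1)// ler_pM2l.
  have h4 : e * `|E| <= e * (C * (1 + e * `|E|)) by rewrite ler_pM2l.
  have h5 : e * (C * (1 + e * `|E|)) = 3%:R^-1 * (1 + e * `|E|).
    rewrite mulrA; congr (_ * _); apply: (@mulfI _ 3%:R) => //.
    by rewrite mulrA eC mulfV.
  by rewrite h5 in h4; lra.
have [g ga gE] := gen_alg_inv (gen_algZ e Ea) eE.
exists (E ** g); first exact: gen_algM.
by rewrite (gen_algA uua Ea ga) uuE.
Qed.

(** Invertibility leaves room for a constant: u^2 - c^2 is a square k^2 for some c > 0. As 1 - u^2
    is a square too, its norm is at most that of 1 - u^2 + k^2 = (1 - c^2) 1. *)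
Lemma norm_one_sub_sqr_lt u : jinvertible u -> `|u| < 1 ->
  `|jone - u ** u| < 1.
Proof.
move=> u_inv u1; have [w wa uuw] := gen_alg_sqr_inv u_inv u1.
have ua := @gen_alg_id _ _ u; have a1 := @gen_alg1 _ _ u.
have uua := gen_algM ua ua; have uwa := gen_algM ua wa.
(* This [c] makes x = c u w of norm less than 1, so 1 - x^2 has a square root, and k = u sqrt(1 -
   x^2) satisfies k^2 = u^2 - c^2. *)
pose c := (1 + `|u ** w|)^-1.
have c0 : 0 < c by rewrite invr_gt0 ltr_pwDl.
have c1 : c <= 1 by rewrite invf_le1 ?lerDl// ltr_pwDl.
pose x := c *: (u ** w).
have x1 : `|x| < 1.
  rewrite normrZ (ger0_norm (ltW c0)) mulrC ltr_pdivrMr ?ltr_pwDl//.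
  by rewrite mul1r ltrDr.
have xx1 : `|x ** x| < 1 by rewrite jb_norm_sq expr_lt1.
have xa : gen_alg u x by exact: gen_algZ.
have uuxx : (u ** u) ** (x ** x) = c ^+ 2 *: jone.
  rewrite /x !jmulE scalerA -expr2; congr (_ *: _).
  rewrite -(gen_algA ua ua (gen_algM uwa uwa)) (gen_algA ua uwa uwa).
  rewrite (gen_algA ua ua wa) uuw jmul1x.
  by rewrite (gen_algA ua ua wa) uuw.
have [t [ta _ tE]] := gen_alg_sqrt (gen_algM xa xa) xx1.
have [t' [_ _ t'E]] : exists t', [/\ gen_alg u t', `|t'| <= `|u ** u|
    & (jone - t') ** (jone - t') = jone - u ** u].
  by apply: gen_alg_sqrt => //; rewrite jb_norm_sq expr_lt1.
have sa : gen_alg u (jone - t) by exact: gen_algB.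
pose k := u ** (jone - t).
have kk : k ** k = u ** u - c ^+ 2 *: jone.
  rewrite /k -(gen_algA ua sa (gen_algM ua sa)) (jmulC u (jone - t)).
  rewrite (gen_algA sa sa ua) tE (jmulC _ u).
  rewrite (gen_algA ua ua); last by apply: gen_algB => //; exact: gen_algM.
  by rewrite jmulDr jmulNr uuxx jmulx1.
have c2 : 0 < c ^+ 2 <= 1 by rewrite exprn_gt0//= expr_le1// ltW.
rewrite -t'E (le_lt_trans (jb_norm_sqD _ k))// t'E kk.
have -> : jone - u ** u + (u ** u - c ^+ 2 *: jone) = (1 - c ^+ 2) *: (jone : V).
  lmod R.
have := jb_norm1; have := normr_ge0 (jone : V).
rewrite normrZ ger0_norm; last by rewrite subr_ge0; case/andP: c2.
by nra.
Qed.

(** For l <= 0, k(1 - t) - l = (k - l)(1 - (k/(k - l)) t) with k/(k - l) <= 1, so [gen_alg_inv]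
    applies. *)
Lemma jcone_near_one a t k : gen_alg a t -> `|t| < 1 -> 0 < k ->
  jcone V (k *: (jone - t)).
Proof.
move=> ta t1 k0 l /= l_spec; rewrite ltNge; apply/negP => l0; apply: l_spec.
have kl : 0 < k - l by lra.
have a1 := @gen_alg1 _ _ a.
have [y ya yE] : exists2 y, gen_alg a y &
    (jone - (k / (k - l)) *: t) ** y = jone.
  apply: gen_alg_inv; first exact: gen_algZ.
  rewrite normrZ ger0_norm; last by rewrite divr_ge0// ltW.
  rewrite (le_lt_trans _ t1)// ler_piMl// ler_pdivrMr// mul1r; lra.
have xE : k *: (jone - t) - l *: jone = (k - l) *: (jone - (k / (k - l)) *: t).
  rewrite (scalerBr (k - l)) scalerA mulrC divfK ?lt0r_neq0//; lmod R.
rewrite xE; apply: (@gen_alg_jinvertible _ _ a _ ((k - l)^-1 *: y)).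
- by apply: gen_algZ; apply: gen_algB => //; exact: gen_algZ.
- exact: gen_algZ.
- by rewrite jmulZl jmulZr yE scalerA divff ?scale1r// lt0r_neq0.
Qed.

Lemma jinvertibleZ k u : k != 0 -> jinvertible u -> jinvertible (k *: u).
Proof.
move=> k0 /jinvertibleP[y uy]; apply/jinvertibleP; exists (k ^- 2 *: y).
rewrite UopZ UopE jtripleZl jtripleZr !scalerA -UopE uy -mulrA -expr2.
by rewrite mulVf ?scale1r// expf_neq0.
Qed.

(** Two square roots give r = (u^2)^(1/2) and v = r^(1/2) = 1 - t. With x = u^-2, the inverse of r
    is rx; then s = u r^-1 and w = v r^-1 = v^-1. *)
Lemma jb_polar u : jinvertible u -> `|u| < 1 ->
  exists t w s, [/\ [/\ gen_alg u t, gen_alg u w & gen_alg u s], `|t| < 1,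
    (jone - t) ** w = jone, s ** s = jone
    & ((jone - t) ** (jone - t)) ** s = u].
Proof.
move=> u_inv u1; have [x xa uux] := gen_alg_sqr_inv u_inv u1.
have ua := @gen_alg_id _ _ u; have a1 := @gen_alg1 _ _ u.
have uua := gen_algM ua ua.
have [q [qa q1 qE]] := gen_alg_sqrt (gen_algB a1 uua)
  (norm_one_sub_sqr_lt u_inv u1).
rewrite subKr in qE.
have {}q1 : `|q| < 1 by exact: le_lt_trans q1 (norm_one_sub_sqr_lt u_inv u1).
have [t [ta t1 tE]] := gen_alg_sqrt qa q1.
have {}t1 : `|t| < 1 by exact: le_lt_trans t1 q1.
set r := jone - q in qE tE; set v := jone - t in tE *.
have ra : gen_alg u r by exact: gen_algB.
have va : gen_alg u v by exact: gen_algB.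
have rxa := gen_algM ra xa.
have rrx : r ** (r ** x) = jone by rewrite (gen_algA ra ra xa) qE.
exists t, (v ** (r ** x)), (u ** (r ** x)); split=> //.
- by split=> //; apply: gen_algM.
- by rewrite (gen_algA va va rxa) tE.
- rewrite -(gen_algA ua rxa (gen_algM ua rxa)) (gen_alg_opcomm rxa ua).
  rewrite (gen_algA ua ua (gen_algM rxa rxa)).
  rewrite -(gen_algA ra xa rxa) (gen_alg_opcomm ra xa).
  by rewrite rrx jmulx1.
- by rewrite tE (gen_alg_opcomm ra ua) rrx jmulx1.
Qed.

Lemma jb_polar_decomposition u : jinvertible u ->
  exists v w s, [/\ jcone V v, jinvertible w, s ** s = jone,
    Uop w u = s & Uop v s = u /\ (v ** v) ** s = u].
Proof.
(* Dividing by [c] brings the norm below 1; [v] is then rescaled by sqrt c, since [U_v] is quadratic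
   in [v]. *)
move=> u_inv; pose c := `|u| + 1.
have c0 : 0 < c by rewrite ltr_wpDl.
have cV0 : c^-1 != 0 by rewrite invr_eq0 lt0r_neq0.
have [|t [w [s [[ta wa sa] t1 vw ss vvs]]]] := jb_polar (jinvertibleZ cV0 u_inv).
  by rewrite normrZ ger0_norm ?invr_ge0 ?ltW// mulrC ltr_pdivrMr// mul1r ltrDl.
set v := jone - t in vw vvs; set u' := c^-1 *: u in ta wa sa vvs.
have va : gen_alg u' v by apply: gen_algB => //; exact: gen_alg1.
have c12 : Num.sqrt c * Num.sqrt c = c by rewrite -expr2 sqr_sqrtr// ltW.
have sc0 : 0 < Num.sqrt c by rewrite sqrtr_gt0.
have uE : u = c *: u' by rewrite scalerA divff ?scale1r// lt0r_neq0.
have vva : gen_alg u' (Num.sqrt c *: v) by exact: gen_algZ.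
have vvE : ((Num.sqrt c *: v) ** (Num.sqrt c *: v)) ** s = u.
  by rewrite jmulZl jmulZr scalerA c12 jmulZl vvs -uE.
have wa' : gen_alg u' ((Num.sqrt c)^-1 *: w) by exact: gen_algZ.
have wv : ((Num.sqrt c)^-1 *: w) ** (Num.sqrt c *: v) = jone.
  by rewrite jmulZl jmulZr scalerA mulVf ?lt0r_neq0// scale1r jmulC.
exists (Num.sqrt c *: v), ((Num.sqrt c)^-1 *: w), s; split=> //.
- exact: (jcone_near_one ta t1 sc0).
- exact: (gen_alg_jinvertible wa' vva wv).
- set W := _ *: w in wa' wv *; set X := _ *: v in vva vvE wv *.
  have Xsa := gen_algM vva sa; have XXs := gen_algM (gen_algM vva vva) sa.
  rewrite -[in LHS]vvE (gen_alg_Uop wa' XXs) -(gen_algA wa' wa' XXs).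
  rewrite -(gen_algA vva vva sa) (gen_algA wa' vva Xsa) wv jmul1x.
  by rewrite (gen_algA wa' vva sa) wv jmul1x.
- by rewrite (gen_alg_Uop vva sa).
Qed.

End FunctionalCalculus.

(** * Isotopes by symmetries *)

Section CentralSymmetries.
Variables (R : realType) (V : jordanAlgType R).
Implicit Types (e p s w x y z : V).

(** With two arguments equal to [s] and s^2 = 1, the terms w y cancel in the linearized Jordan
    identity. *)
Lemma opcomm_symmetry_mul s w : s ** s = jone -> opcomm s (s ** w).
Proof.
move=> ss y; have h := jordan_linearized w s s y.
rewrite ss !jmulE (jmulC w s) in h.
apply: (lmod_add_eq (- 2%:R^-1) h); lmod R.
Qed.

Lemma symmetry_mul_cube s w : s ** s = jone -> s ** (s ** (s ** w)) = s ** w.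
Proof.
move=> ss; have := opcomm_symmetry_mul w ss s.
by rewrite ss jmulx1 (jmulC (s ** w) s).
Qed.

Lemma opcomm_symmetry s w : s ** s = jone -> s ** (s ** w) = w -> opcomm s w.
Proof. by move=> ss {1}<-; exact: opcomm_symmetry_mul. Qed.

Lemma isotope_mul_opcomm s x y : opcomm s x -> opcomm s y ->
  isotope_mul s x y = s ** (x ** y).
Proof.
move=> sx sy; rewrite isotope_mulE /jtriple (jmulC (x ** s) y) (jmulC x s).
rewrite -sx -sy (jmulC y x); lmod R.
Qed.

Lemma isotope_mul_symmetryl s y : s ** s = jone -> isotope_mul s s y = y.
Proof. by move=> ss; rewrite isotope_mulE /jtriple ss jmul1x addrK. Qed.

Lemma csym_sqr p : central_projection p -> csym p ** csym p = jone.
Proof. by move=> [pp _]; rewrite /csym !jmulE pp; lmod R. Qed.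

Lemma csym_opcomm p x : central_projection p -> opcomm (csym p) x.
Proof.
move=> [_ p_central] w; have /(congr1 (@^~ w)) /= := p_central x.
by rewrite /Lop /csym !jmulE => ->.
Qed.

Lemma csym_of_symmetry s : s ** s = jone -> (forall x, opcomm s x) ->
  central_projection (2%:R^-1 *: (jone + s)) /\
  csym (2%:R^-1 *: (jone + s)) = s.
Proof.
move=> ss s_central; split; last first.
  by rewrite /csym scalerA mulfV ?pnatr_eq0// scale1r addrC addKr.
split; first by rewrite !jmulE ss; lmod R.
by move=> z; apply/funext => w; rewrite /= /Lop !jmulE s_central.
Qed.

Lemma isotope_csym_isomorphic p : central_projection p ->
  jordan_isomorphic (isotope_mul (csym p)) (@jmul R V).
Proof.
move=> p_central; have e_comm x := csym_opcomm x p_central.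
have eK x : csym p ** (csym p ** x) = x.
  by rewrite (jmulC _ x) e_comm csym_sqr// jmulx1.
exists (jmul_linear (csym p)); split; first by exists (jmul (csym p)) => x /=.
move=> x y /=; rewrite isotope_mul_opcomm// eK.
by rewrite -e_comm (jmulC (csym p ** x) y) -e_comm eK jmulC.
Qed.

End CentralSymmetries.

(** * Centrality of the symmetry from formal reality *)

Section SymmetryIsotopes.
Variables (R : realType) (V : jbAlgType R).
Implicit Types (s t w x y : V).

(** The root is taken of 1 - (1 + e)^-1 (1 - x^2). It lies in the algebra generated by x^2, and in
    [symmetry_isotope_kernel] [s] is known to operator-commute with x^2. *)
Lemma sqr_add_scale_one_sqrt x (e : R) : `|x| < 1 -> 0 < e ->
  exists2 w, gen_alg (x ** x) w & w ** w = x ** x + e *: jone.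
Proof.
move=> x1 e0; have e1 : 0 < 1 + e by rewrite addr_gt0.
have a1 := @gen_alg1 _ _ (x ** x); have xxa := @gen_alg_id _ _ (x ** x).
have [t [ta _ tE]] : exists t, [/\ gen_alg (x ** x) t,
    `|t| <= `|(1 + e)^-1 *: (jone - x ** x)|
    & (jone - t) ** (jone - t) = jone - (1 + e)^-1 *: (jone - x ** x)].
  apply: gen_alg_sqrt; first by apply: gen_algZ; exact: gen_algB.
  rewrite normrZ ger0_norm; last by rewrite invr_ge0 ltW.
  rewrite (@le_lt_trans _ _ (1 + e)^-1)//.
    by rewrite -[leRHS]mulr1 ler_wpM2l ?norm_one_sub_sqr// invr_ge0 ltW.
  by rewrite invf_lt1 ?ltrDl.
exists (Num.sqrt (1 + e) *: (jone - t)).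
  by apply: gen_algZ; exact: gen_algB.
rewrite jmulZl jmulZr scalerA -expr2 sqr_sqrtr ?ltW// tE scalerBr scalerA.
rewrite mulfV ?lt0r_neq0// scale1r; lmod R.
Qed.

(* On the kernel of [L_s] the square in [V_s] of [x] is [- s x^2], which
   [w = sqrt (x^2 + e)] compensates up to [e s]; but [V_s], being isomorphic
   to [V], is formally real. *)
Lemma symmetry_isotope_kernel s x :
  jordan_isomorphic (isotope_mul s) (@jmul R V) -> s ** s = jone ->
  s ** x = 0 -> x = 0.
Proof.
move=> [f [f_bij fM]] ss.
wlog x1 : x / `|x| < 1 => [hw sx|sx].
  have k0 : 0 < (1 + `|x|)^-1 by rewrite invr_gt0 ltr_pwDl.
  have /eqP : (1 + `|x|)^-1 *: x = 0.
    apply: hw; last by rewrite jmulZr sx scaler0.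
    rewrite normrZ (ger0_norm (ltW k0)) mulrC ltr_pdivrMr ?ltr_pwDl//.
    by rewrite mul1r ltrDr.
  by rewrite scaler_eq0 gt_eqF// => /eqP.
have f_s : f s = jone.
  have [y yE] : exists y, f y = jone by have [g _ gK] := f_bij; exists (g jone).
  by rewrite -[LHS]jmulx1 -yE -fM isotope_mul_symmetryl.
have s_xx : opcomm s (x ** x).
  apply: opcomm_sqr_of_mul; rewrite sx => w.
  by rewrite !(jmulC 0) !jmul0r.
(* [L_s^2] fixes 1 and commutes with [L_{x^2}], so it fixes the closed algebra generated by x^2;
   [opcomm_symmetry] then applies to [w]. *)
have gen_fixed y : gen_alg (x ** x) y -> s ** (s ** y) = y.
  move=> ya; apply: (ya [set y | s ** (s ** y) = y]) => [|z /= sz]; last first.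
    by rewrite !s_xx sz.
  split=> [||k y1 y2 /= h1 h2].
  - apply: closed_equalizer; last by move=> z; exact: cvg_id.
    exact: (continuous_jmulr (@jmul_continuous _ _ s)).
  - by rewrite /= jmulx1.
  - by rewrite !jmulE h1 h2.
have fx_small e : 0 < e -> `|f x| ^+ 2 <= e.
  move=> e0; have [w wa ww] := sqr_add_scale_one_sqrt x1 e0.
  have s_w : opcomm s w by apply: opcomm_symmetry => //; exact: gen_fixed.
  have xwE : isotope_mul s x x + isotope_mul s w w = e *: s.
    rewrite (isotope_mul_opcomm s_w s_w) ww isotope_mulE /jtriple.
    by rewrite (jmulC x s) sx (jmulC 0) !jmulE !jmul0r; lmod R.
  have fxw : f x ** f x + f w ** f w = e *: jone.
    by rewrite -!fM -linearD xwE linearZ /= f_s.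
  rewrite -jb_norm_sq (le_trans (jb_norm_sqD _ (f w)))// fxw normrZ gtr0_norm//.
  by rewrite ler_piMr ?jb_norm1// ltW.
have /eqP : `|f x| ^+ 2 = 0.
  apply/eqP; rewrite eq_le sqr_ge0 andbT; apply/ler_addgt0Pr => e /fx_small.
  by rewrite add0r.
rewrite sqrf_eq0 normr_eq0 => /eqP fx0.
by apply: (bij_inj f_bij); rewrite fx0 linear0.
Qed.

(** By [L_s^3 = L_s], x - s(sx) lies in the kernel of [L_s], which is zero. *)
Lemma symmetry_isotope_central s :
  jordan_isomorphic (isotope_mul s) (@jmul R V) -> s ** s = jone ->
  forall x, opcomm s x.
Proof.
move=> s_iso ss x; apply: opcomm_symmetry => //.
apply/esym/subr0_eq; apply: (symmetry_isotope_kernel s_iso ss).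
by rewrite jmulDr jmulNr symmetry_mul_cube// subrr.
Qed.

Lemma jcone_jinvertible v : jcone V v -> jinvertible v.
Proof.
move=> v_cone; apply: contrapT => v_ninv.
suff : 0 < 0 :> R by rewrite ltxx.
by apply: (v_cone 0); rewrite /jspectrum /= scale0r subr0.
Qed.

End SymmetryIsotopes.

Theorem corollary3p46 (R : realType) (V : jbAlgType R) (u : V)
    (hu : jinvertible u) :
  jordan_isomorphic (isotope_mul u) (@jmul R V) <->
  exists v p : V,
    [/\ jcone V v, central_projection p,
        u = Uop v (csym p) & Uop v (csym p) = (v ** v) ** csym p].
Proof.
split=> [u_iso|[v [p [v_cone p_central -> _]]]]; last first.
  apply: jordan_isomorphic_trans (isotope_csym_isomorphic p_central).
  exact/isotope_isomorphic/jcone_jinvertible.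
have [v [w [s [v_cone w_inv ss wu [vs vvs]]]]] := jb_polar_decomposition hu.
(* [U_w u = s] makes [U_w] an isomorphism from [V_s] onto [V_u]. *)
have s_iso : jordan_isomorphic (isotope_mul s) (@jmul R V).
  apply: jordan_isomorphic_trans u_iso.
  by rewrite -wu; exact: isotope_isomorphic.
have [p_central pE] := csym_of_symmetry ss (symmetry_isotope_central s_iso ss).
by exists v, (2%:R^-1 *: (jone + s)); split=> //; rewrite pE ?vs ?vvs.
Qed.
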